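(* Let $(N,\mu,\nu)$ be an intuitionistic fuzzy normed space, let $(u_k)_{k\ge 1}$ be a sequence in $N$ and let $a\in N$. If $(u_k)$ is statistically convergent to $a$ with respect to $(\mu,\nu)$ and slowly oscillating with respect to logarithmic summability, then $(u_k)$ is convergent to $a$ in $(N,\mu,\nu)$.
   Context: An intuitionistic fuzzy normed space (IFNS) is a triple $(N,\mu,\nu)$ where $N$ is a real vector space with zero vector $\theta$ and $\mu,\nu:N\times\mathbb{R}\to[0,1]$ satisfy, for all $u,w\in N$ and $t,s\in\mathbb{R}$: (a) $\mu(u,t)=0$ for $t\le 0$; (b) $\mu(u,t)=1$ for all $t>0$ if and only if $u=\theta$; (c) $\mu(cu,t)=\mu(u,t/|c|)$ for all $t>0$ and real $c\ne 0$; (d) $\mu(u+w,t+s)\ge\min\{\mu(u,t),\mu(w,s)\}$; (e) $\lim_{t\to\infty}\mu(u,t)=1$, and $\lim_{t\to 0}\mu(u,t)=0$ if $u\neq\theta$; (f) $\nu(u,t)=1$ for $t\le 0$; (g) $\nu(u,t)=0$ for all $t>0$ if and only if $u=\theta$; (h) $\nu(cu,t)=\nu(u,t/|c|)$ for all $t>0$ and real $c\neq 0$; (i) $\max\{\nu(u,t),\nu(w,s)\}\ge\nu(u+w,t+s)$; (j) $\lim_{t\to\infty}\nu(u,t)=0$, and $\lim_{t\to0}\nu(u,t)=1$ if $u\ne\theta$. A sequence $(u_k)$ in $N$ is convergent to $a\in N$ if for every $\varepsilon>0$ and $t>0$ there is $k_0\in\mathbb{N}$ such that $\mu(u_k-a,t)>1-\varepsilon$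 and $\nu(u_k-a,t)<\varepsilon$ for all $k\ge k_0$. $(u_k)$ is statistically convergent to $a\in N$ with respect to $(\mu,\nu)$ if for every $\varepsilon>0$ and $t>0$, $\lim_{n\to\infty}\frac1n\left|\{k\le n:\mu(u_k-a,t)\le 1-\varepsilon\text{ or }\nu(u_k-a,t)\ge\varepsilon\}\right|=0$. $(u_k)$ is slowly oscillating with respect to logarithmic summability if for all $t>0$ and all $\varepsilon\in(0,1)$ there exist $\lambda>1$ and $m_0\in\mathbb{N}$ (depending on $t$ and $\varepsilon$) such that $\mu(u_k-u_n,t)>1-\varepsilon$ and $\nu(u_k-u_n,t)<\varepsilon$ whenever $m_0\le n<k\le\lfloor n^{\lambda}\rfloor$. *)

(* Defs.v *)
From HB Require Import structures.
From mathcomp Require Import all_boot all_order all_algebra.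
From mathcomp Require Import all_classical all_reals all_analysis.
Set Implicit Arguments.
Unset Strict Implicit.
Unset Printing Implicit Defensive.
Import Order.TTheory GRing.Theory Num.Theory.
Import numFieldNormedType.Exports.
Local Open Scope classical_set_scope.
Local Open Scope ring_scope.

(* Intuitionistic fuzzy normed space (N, mu, nu). *)
Record is_ifns (R : realType) (N : lmodType R) (mu nu : N -> R -> R) : Prop :=
  IsIFNS {
  ifns_mu_range : forall u t, 0 <= mu u t <= 1;
  ifns_nu_range : forall u t, 0 <= nu u t <= 1;
  ifns_mu_npos : forall u t, t <= 0 -> mu u t = 0;
  ifns_mu_eq1 : forall u, (forall t, 0 < t -> mu u t = 1) <-> u = 0;
  ifns_muZ : forall (c : R) u t, 0 < t -> c != 0 ->
    mu (c *: u) t = mu u (t / `|c|);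
  ifns_muD : forall u w t s, mu (u + w) (t + s) >= Num.min (mu u t) (mu w s);
  ifns_mu_pinfty : forall u, mu u t @[t --> +oo] --> (1 : R);
  ifns_mu_0 : forall u, u != 0 -> mu u t @[t --> (0 : R)^'] --> (0 : R);
  ifns_nu_npos : forall u t, t <= 0 -> nu u t = 1;
  ifns_nu_eq0 : forall u, (forall t, 0 < t -> nu u t = 0) <-> u = 0;
  ifns_nuZ : forall (c : R) u t, 0 < t -> c != 0 ->
    nu (c *: u) t = nu u (t / `|c|);
  ifns_nuD : forall u w t s, Num.max (nu u t) (nu w s) >= nu (u + w) (t + s);
  ifns_nu_pinfty : forall u, nu u t @[t --> +oo] --> (0 : R);
  ifns_nu_0 : forall u, u != 0 -> nu u t @[t --> (0 : R)^'] --> (1 : R)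
}.

(* Sequences (u_k) with k >= 1 are represented by functions nat -> N whose
   value at 0 is never used. *)

Definition ifns_cvg (R : realType) (N : lmodType R) (mu nu : N -> R -> R)
    (u : nat -> N) (a : N) : Prop :=
  forall eps t : R, 0 < eps -> 0 < t ->
  exists k0 : nat, forall k : nat, (0 < k)%N -> (k0 <= k)%N ->
    mu (u k - a) t > 1 - eps /\ nu (u k - a) t < eps.

Definition ifns_stat_cvg (R : realType) (N : lmodType R) (mu nu : N -> R -> R)
    (u : nat -> N) (a : N) : Prop :=
  forall eps t : R, 0 < eps -> 0 < t ->
  (n%:R^-1 * (count (fun k : nat => (mu (u k - a) t <= 1 - eps)
                                    || (nu (u k - a) t >= eps))
                    (index_iota 1 n.+1))%:R)
    @[n --> \oo] --> (0 : R).

Definition slowly_oscillating_log (R : realType) (N : lmodType R)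
    (mu nu : N -> R -> R) (u : nat -> N) : Prop :=
  forall t eps : R, 0 < t -> 0 < eps < 1 ->
  exists (lambda : R) (m0 : nat), 1 < lambda /\
    forall n k : nat, (0 < n)%N -> (m0 <= n)%N -> (n < k)%N ->
      k%:Z <= Num.floor (n%:R `^ lambda) ->
      mu (u k - u n) t > 1 - eps /\ nu (u k - u n) t < eps.

(* Main.v *)
(** A set of density zero cannot contain a whole block [k/2 < n < k] once [k]
    is large, so there is such an [n] with [u n] close to [a].  Since
    [k < 2 n <= n ^ lambda] for large [n], slow oscillation makes [u k] close
    to [u n], and the triangle inequalities conclude. *)
Require Import Defs.
From HB Require Import structures.
From mathcomp Require Import all_boot all_order all_algebra.
From mathcomp Require Import all_classical all_reals all_analysis.
From mathcomp Require Import zify lra.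
Import Order.TTheory GRing.Theory Num.Theory.
Import numFieldNormedType.Exports.
Local Open Scope classical_set_scope.
Local Open Scope ring_scope.

Lemma leq_count_index_iota (P : pred nat) (i m n p : nat) :
  (i <= m)%N -> (n <= p)%N -> (forall j, (m <= j < n)%N -> P j) ->
  (n - m <= count P (index_iota i p))%N.
Proof.
move=> im np PT; rewrite -(size_iota m (n - m)) -size_filter.
apply: uniq_leq_size => [|j]; first exact: iota_uniq.
rewrite -/(index_iota m n) mem_filter !mem_index_iota => /[dup] /PT -> /andP[mj jn].
by rewrite (leq_trans im) ?(leq_trans jn).
Qed.

(** Otherwise [P] would hold at all [k - k./2 - 1] integers strictly between [k / 2] and [k]. For
    [k >= 4] this number is at least [k / 4], whereas the density is eventually below [1 / 4]. *)
Lemma density0_near_exists_notin (R : realType) (P : pred nat) :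
  n%:R^-1 * (count P (index_iota 1 n.+1))%:R @[n --> \oo] --> (0 : R) ->
  \forall k \near \oo, exists n, [/\ (k < n.*2)%N, (n < k)%N & ~~ P n].
Proof.
move=> /cvgr0Pnorm_lt cvP.
have e0 : (0 : R) < 4^-1 by rewrite invr_gt0.
near=> k.
have k4 : (4 <= k)%N by near: k; exact: nbhs_infty_ge.
have cnt : (4 * count P (index_iota 1 k.+1) < k)%N.
  have : `|k%:R^-1 * (count P (index_iota 1 k.+1))%:R| < 4^-1 :> R.
    by near: k; exact: cvP.
  rewrite ger0_norm ?mulr_ge0 ?invr_ge0 ?ler0n//.
  rewrite mulrC ltr_pdivrMr ?ltr0n//; last by lia.
  by rewrite mulrC ltr_pdivlMr ?ltr0n// -natrM ltr_nat mulnC.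
apply: contrapT => nex.
have : (k - k./2.+1 <= count P (index_iota 1 k.+1))%N.
  apply: leq_count_index_iota => // j /andP[kj jk].
  by apply: contrapT => /negP PjN; apply: nex; exists j; split=> //; lia.
lia.
Unshelve. all: by end_near. Qed.

(** Factor [n ^ r] as [n ^ (r - 1) * n]; the first factor is at least 2 once
    [n >= 2 ^ (1 / (r - 1))]. *)
Lemma near_mul2_le_powR (R : realType) (r : R) : 1 < r ->
  \forall n \near \oo, 2 * n%:R <= n%:R `^ r.
Proof.
move=> r1; near=> n.
have n0 : (0 : R) < n%:R by near: n; exact: nbhs_infty_gtr.
have n2 : 2 `^ (r - 1)^-1 <= n%:R :> R by near: n; exact: nbhs_infty_ger.
have -> : n%:R `^ r = n%:R `^ (r - 1) * n%:R :> R.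
  rewrite -[in LHS](subrK 1 r) (@powRD _ _ (r - 1)) ?powRr1 ?ler0n//.
  by rewrite (gt_eqF n0) implybT.
rewrite ler_wpM2r ?ler0n//.
have -> : 2 = (2 `^ (r - 1)^-1) `^ (r - 1) :> R.
  by rewrite -powRrM mulVf ?powRr1// subr_eq0 gt_eqF.
by rewrite ge0_ler_powR ?nnegrE ?powR_ge0 ?subr_ge0// ltW.
Unshelve. all: by end_near. Qed.

Theorem theorem3p3 (R : realType) (N : lmodType R) (mu nu : N -> R -> R)
    (u : nat -> N) (a : N) :
  is_ifns mu nu ->
  ifns_stat_cvg mu nu u a ->
  slowly_oscillating_log mu nu u ->
  ifns_cvg mu nu u a.
Proof.
move=> ifns ust uslow eps0 t eps0_gt0 t0.
(* Slow oscillation only accepts tolerances below 1, hence the cap; estimates for [eps] imply those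
   for [eps0]. *)
pose eps := Num.min eps0 2^-1.
have eps_gt0 : 0 < eps by rewrite lt_min eps0_gt0/= invr_gt0.
have eps_le : eps <= eps0 by rewrite ge_min lexx.
have eps_lt1 : eps < 1.
  by rewrite gt_min orbC invf_lt1 ?ltr1n.
have t2 : 0 < t / 2 by rewrite divr_gt0.
have [||lambda [m0 [lambda1 osc]]] := uslow (t / 2) eps => //.
  by rewrite eps_gt0.
have [n1 _ n1P] := near_mul2_le_powR _ _ lambda1.
have [k1 _ k1P] := density0_near_exists_notin _ _ (ust eps (t / 2) eps_gt0 t2).
(* The doubling is for [n]: from [k < 2 n] and [k >= 2 max(m0, n1)] follows [n > max(m0, n1)], so
   that both [osc] and [n1P] apply at [n]. *)
exists (maxn k1 (maxn m0 n1).*2) => k _ kge.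
have [|n [kn nk]] := k1P k; first by rewrite /=; lia.
rewrite negb_or -!ltNge => /andP[mun nun].
have [||||muk nuk] := osc n k => //; [lia|lia| |].
  rewrite floor_ge_int (le_trans _ (n1P n _))//=; last by lia.
  by rewrite -natrM ler_nat; lia.
(* Each of the two differences is controlled at [t / 2], so their sum is controlled at [t]. *)
have uE : u k - a = (u k - u n) + (u n - a) by rewrite addrA subrK.
have tE : t = t / 2 + t / 2 by lra.
rewrite uE tE; split.
  apply: lt_le_trans (ifns_muD ifns _ _ _ _).
  by rewrite lt_min !(le_lt_trans _ muk, le_lt_trans _ mun) ?lerD2l ?lerN2.
apply: le_lt_trans (ifns_nuD ifns _ _ _ _) _.
by rewrite gt_max !(lt_le_trans nuk, lt_le_trans nun).
Qed.
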